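(* Let $(X,\operatorname{dist})$ be a separable, bounded metric space and let $(\mathrm{Dgm}_\infty,w_\infty)$ be the space of persistence diagrams with the bottleneck distance. Regard $X$ as a subset of $\mathrm{Dgm}_\infty$ via the Bubenik–Wagner isometric embedding $$\varphi\colon X\to \mathrm{Dgm}_\infty,\qquad x\mapsto\{(2c(k-1),\,2ck+\operatorname{dist}(x,x_k))\}_{k=1}^\infty,$$ where $c>\operatorname{diam}(X)$ and $\{x_k\}_{k=1}^\infty$ is a countable dense subset of $X$. If $x\in X$ is an accumulation point, then $\operatorname{reach}(x, X\subset \mathrm{Dgm}_\infty)=0$. In particular, if $X$ is not discrete, then $\operatorname{reach}(X\subset \mathrm{Dgm}_\infty)=0$.
   Context: Persistence diagrams: let $\mathbb R^2_<=\{(x,y)\in\mathbb R^2:x<y\}$. A persistence diagram is a function $D\colon I\to\mathbb R^2_<$ from a countable set $I$. A partial matching between $D_1\colon I_1\to\mathbb R^2_<$ and $D_2\colon I_2\to\mathbb R^2_<$ is a triple $(I_1',I_2',f)$ with $I_1'\subseteq I_1$, $I_2'\subseteq I_2$ and $f\colon I_1'\to I_2'$ a bijection. Let $\operatorname{dist}_\infty(a,b)=\max(|a_x-b_x|,|a_y-b_y|)$ on $\mathbb R^2$ and let $\Delta$ be the diagonal of $\mathbb R^2$, so $\operatorname{dist}_\infty(a,\Delta)=(a_y-a_x)/2$ for $a\in\mathbb R^2_<$. The cost of the matching is $$\operatorname{cost}_\infty(f)=\max\left\{\sup_{i\in I_1'}\operatorname{dist}_\infty(D_1(i),D_2(f(i))),\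 \sup_{i\in I_1\setminus I_1'}\operatorname{dist}_\infty(D_1(i),\Delta),\ \sup_{i\in I_2\setminus I_2'}\operatorname{dist}_\infty(D_2(i),\Delta)\right\}$$ (infinite if a term is unbounded). Let $\tilde w_\infty(D_1,D_2)$ be the infimum of $\operatorname{cost}_\infty(f)$ over all partial matchings. $(\mathrm{Dgm}_\infty,w_\infty)$ is the metric space of persistence diagrams $D$ with $\tilde w_\infty(D,\emptyset)<\infty$ ($\emptyset$ being the diagram with empty index set), modulo the relation $D_1\sim D_2$ iff $\tilde w_\infty(D_1,D_2)=0$, with the induced metric $w_\infty$ (the bottleneck distance). Here $\operatorname{diam}(X)=\sup\{\operatorname{dist}(x,y):x,y\in X\}$. The map $\varphi$ is an isometric embedding (a known theorem of Bubenik and Wagner), and $X$ is identified with $\varphi(X)$. Reach: for a metric space $(Y,d)$ and $A\subset Y$, $\operatorname{Unp}(A)=\{y\in Y:\text{there exists a unique } a\in A \text{ with } d(y,A)=d(y,a)\}$; for $a\in A$, $\operatorname{reach}(a,A\subset Y)=\sup\{r\ge 0: B_r(a)\subset\operatorname{Unp}(A)\}$ with $B_r(a)$ the open ball in $Y$; $\operatorname{reach}(A\subset Y)=\inf_{a\in A}\operatorname{reach}(a,A\subset Y)$. ''Not discrete'' means that $X$ has an accumulation point. *)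

(* Defs.v *)
From HB Require Import structures.
From mathcomp Require Import all_boot all_order all_algebra generic_quotient.
From mathcomp Require Import all_classical all_reals all_analysis.
From mathcomp Require Import lra.

Set Implicit Arguments.
Unset Strict Implicit.
Unset Printing Implicit Defensive.

Import Order.TTheory GRing.Theory Num.Theory.
Import numFieldNormedType.Exports.

Local Open Scope classical_set_scope.
Local Open Scope ring_scope.
Local Open Scope quotient_scope.

Definition point_set_dist (R : realType) (T : Type) (d : T -> T -> R)
  (y : T) (A : set T) : R := inf [set d y a | a in A].

Section plane.
Context {R : realType}.
Implicit Types a b p : R * R.

Definition dist_oo a b : R := Num.max `|a.1 - b.1| `|a.2 - b.2|.

Definition diagonal : set (R * R) := [set p | p.1 = p.2].

Definition dist_diag a : R := point_set_dist dist_oo a diagonal.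

Lemma dist_oo_ge0 a b : 0 <= dist_oo a b.
Proof. by rewrite le_max normr_ge0. Qed.

Lemma dist_ooxx a : dist_oo a a = 0.
Proof. by rewrite /dist_oo !subrr normr0 maxxx. Qed.

Lemma dist_ooC a b : dist_oo a b = dist_oo b a.
Proof. by rewrite /dist_oo distrC [`|a.2 - _|]distrC. Qed.

Lemma dist_oo_triangle b a p : dist_oo a p <= dist_oo a b + dist_oo b p.
Proof.
rewrite ge_max; apply/andP; split.
  apply: le_trans (ler_distD b.1 _ _) _.
  by apply: lerD; rewrite /dist_oo le_max lexx.
apply: le_trans (ler_distD b.2 _ _) _.
by apply: lerD; rewrite /dist_oo le_max lexx orbT.
Qed.

Lemma dist_diag_le a p : diagonal p -> dist_diag a <= dist_oo a p.
Proof.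
move=> dp; apply: ge_inf; last by exists p.
by exists 0 => _ [q _ <-]; exact: dist_oo_ge0.
Qed.

Lemma le_dist_diag a (e : R) :
  (forall p, diagonal p -> e <= dist_oo a p) -> e <= dist_diag a.
Proof.
move=> h; apply: lb_le_inf; last by move=> _ [p dp <-]; exact: h.
by exists (dist_oo a (0, 0)); exists (0, 0).
Qed.

Lemma dist_diag_triangle b a : dist_diag a <= dist_oo a b + dist_diag b.
Proof.
rewrite -lerBlDl; apply: le_dist_diag => p dp; rewrite lerBlDl.
exact: le_trans (dist_diag_le a dp) (dist_oo_triangle _ _ _).
Qed.

Lemma dist_diag_ge0 a : 0 <= dist_diag a.
Proof. by apply: le_dist_diag => p _; exact: dist_oo_ge0. Qed.

Lemma dist_diagE a : a.1 <= a.2 -> dist_diag a = (a.2 - a.1) / 2.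
Proof.
move=> a12; apply/eqP; rewrite eq_le; apply/andP; split.
  have dp : diagonal ((a.1 + a.2) / 2, (a.1 + a.2) / 2) by [].
  apply: le_trans (dist_diag_le a dp) _ => /=.
  by rewrite ge_max !ler_norml; apply/andP; split; apply/andP; split => /=; lra.
apply: le_dist_diag => -[s t]; rewrite /diagonal/= => <-.
rewrite /dist_oo/= le_max; apply/orP.
have [sm|ms] := leP s ((a.1 + a.2) / 2).
  by right; apply: le_trans (ler_norm _); lra.
by left; rewrite distrC; apply: le_trans (ler_norm _); lra.
Qed.

End plane.

Section diagrams.
Context {R : realType}.

Record diagram := Diagram {
  dgm_index : Type ;
  dgm_countable : countable [set: dgm_index] ;
  dgm_pt :> dgm_index -> R * R ;
  dgm_lt : forall i, (dgm_pt i).1 < (dgm_pt i).2 }.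

HB.instance Definition _ := gen_eqMixin diagram.
HB.instance Definition _ := gen_choiceMixin diagram.

(* The carriers [m_dom] and [m_cod] coerce to the subtypes they span, so
   [m_fun] is a bijection between the two subsets only. *)
Record matching (D1 D2 : diagram) := Matching {
  m_dom : set (dgm_index D1) ;
  m_cod : set (dgm_index D2) ;
  m_fun : m_dom -> m_cod ;
  m_bij : bijective m_fun }.

(* [ereal_sup set0] is -oo; the suprema in the cost are taken in [0, +oo],
   hence the outer maximum with 0. *)
Definition cost (D1 D2 : diagram) (f : matching D1 D2) : \bar R :=
  maxe 0%E
 (maxe (ereal_sup
         [set (dist_oo (D1 (val i)) (D2 (val (m_fun i))))%:E
         | i in [set: m_dom f]])
 (maxe (ereal_sup [set (dist_diag (D1 i))%:E | i in ~` m_dom f])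
       (ereal_sup [set (dist_diag (D2 j))%:E | j in ~` m_cod f]))).

Definition wtilde (D1 D2 : diagram) : \bar R :=
  ereal_inf (range (@cost D1 D2)).

Definition dgm_empty : diagram :=
  @Diagram void (countableP _) (fun i => match i with end)
    (fun i => match i with end).

Definition m_graph D1 D2 (f : matching D1 D2) i j : Prop :=
  exists p : m_dom f, val p = i /\ val (m_fun p) = j.

Section graph.
Context (D1 D2 : diagram).
Implicit Types (f : matching D1 D2) (e : \bar R).

Lemma m_domP f i : m_dom f i <-> exists j, m_graph f i j.
Proof.
split=> [fi|[_ [p [<- _]]]]; last exact: set_valP.
exists (val (m_fun (SigSub (mem_set fi)))).
by exists (SigSub (mem_set fi)).
Qed.

Lemma m_codP f j : m_cod f j <-> exists i, m_graph f i j.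
Proof.
split=> [fj|[_ [p [_ <-]]]]; last exact: set_valP.
have [g _ gK] := m_bij f.
exists (val (g (SigSub (mem_set fj)))), (g (SigSub (mem_set fj))).
by rewrite gK.
Qed.

Lemma cost_leP f e : (0 <= e)%E ->
  ((cost f <= e)%E <->
   [/\ forall i j, m_graph f i j -> ((dist_oo (D1 i) (D2 j))%:E <= e)%E,
       forall i, ~ (exists j, m_graph f i j) -> ((dist_diag (D1 i))%:E <= e)%E
     & forall j, ~ (exists i, m_graph f i j) ->
         ((dist_diag (D2 j))%:E <= e)%E]).
Proof.
move=> e0; rewrite /cost !ge_max e0 /=; split.
  move=> /andP[/ereal_supP h1 /andP[/ereal_supP h2 /ereal_supP h3]].
  split=> [_ _ [p [<- <-]]|i ni|j nj].
  - by apply: h1; exists p.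
  - by apply: h2; exists i => //= /m_domP.
  - by apply: h3; exists j => //= /m_codP.
move=> [h1 h2 h3]; apply/andP; split.
  by apply: ge_ereal_sup => _ [p _ <-]; apply: h1; exists p.
apply/andP; split; apply: ge_ereal_sup => _ [i ni <-].
  by apply: h2 => /m_domP.
by apply: h3 => /m_codP.
Qed.

Lemma cost_ge0 f : (0 <= cost f)%E.
Proof. by rewrite le_max lexx. Qed.

Lemma m_graph_fun f i j k : m_graph f i j -> m_graph f i k -> j = k.
Proof. by move=> [p [<- <-]] [q [/val_inj -> <-]]. Qed.

Lemma m_graph_inj f i j k : m_graph f i k -> m_graph f j k -> i = j.
Proof.
by move=> [p [<- <-]] [q [<- /val_inj/(bij_inj (m_bij f)) ->]].
Qed.

Lemma matching_of_graph (r : dgm_index D1 -> dgm_index D2 -> Prop) :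
  (forall i j k, r i j -> r i k -> j = k) ->
  (forall i j k, r i k -> r j k -> i = j) ->
  exists f : matching D1 D2, forall i j, m_graph f i j <-> r i j.
Proof.
move=> rf ri.
pose A := [set i | exists j, r i j]; pose B := [set j | exists i, r i j].
have hF (p : A) : {q : B | r (val p) (val q)}.
  apply: cid; have [j rj] := set_valP p.
  have Bj : j \in B by apply/mem_set; exists (val p).
  by exists (SigSub Bj).
have hG (q : B) : {p : A | r (val p) (val q)}.
  apply: cid; have [i ij] := set_valP q.
  have Ai : i \in A by apply/mem_set; exists (val q).
  by exists (SigSub Ai).
have bij : bijective (fun p => sval (hF p)).
  exists (fun q => sval (hG q)) => [p|q]; apply: val_inj.
    by case: hG => p' /= rp'; case: hF rp' => q' /= rp rp'; exact: ri rp' rp.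
  by case: hF => q' /= rq'; case: hG rq' => p' /= rq rq'; exact: rf rq' rq.
exists (Matching bij) => i j; split=> [[p [<- <-]]/=|rij].
  by case: (hF p).
have Ai : i \in A by apply/mem_set; exists j.
exists (SigSub Ai); split=> //=.
by case: (hF _) => q /= riq; exact: rf riq rij.
Qed.

End graph.

Lemma wtilde_ge0 D1 D2 : (0 <= wtilde D1 D2)%E.
Proof. by apply: le_ereal_inf_tmp => _ [f _ <-]; exact: cost_ge0. Qed.

Lemma wtilde_le_cost D1 D2 (f : matching D1 D2) : (wtilde D1 D2 <= cost f)%E.
Proof. by apply: ge_ereal_inf; exists (cost f) => //; exists f. Qed.

Lemma wtildexx D : wtilde D D = 0%E.
Proof.
apply/eqP; rewrite eq_le wtilde_ge0 andbT.
have [||f fE] := @matching_of_graph D D eq; [by move=> ? ? ? -> ->|by move=> ? ? ? -> ->|].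
apply: le_trans (wtilde_le_cost f) _; apply/cost_leP => //; split.
- by move=> i j /fE ->; rewrite dist_ooxx.
- by move=> i []; exists i; apply/fE.
- by move=> i []; exists i; apply/fE.
Qed.

Lemma wtilde_le_sym D1 D2 : (wtilde D1 D2 <= wtilde D2 D1)%E.
Proof.
apply: le_ereal_inf_tmp => _ [f _ <-].
have [||g gE] := @matching_of_graph D1 D2 (fun i j => m_graph f j i).
- by move=> i j k; exact: m_graph_inj.
- by move=> i j k; exact: m_graph_fun.
apply: le_trans (wtilde_le_cost g) _; apply/cost_leP; first exact: cost_ge0.
have [h1 h2 h3] := (cost_leP f (cost_ge0 f)).1 (lexx _).
split=> [i j /gE fji|i ni|j nj].
- by rewrite dist_ooC; exact: h1.
- by apply: h3 => -[j fji]; apply: ni; exists j; apply/gE.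
- by apply: h2 => -[i fji]; apply: nj; exists i; apply/gE.
Qed.

Lemma wtilde_sym D1 D2 : wtilde D1 D2 = wtilde D2 D1.
Proof. by apply/eqP; rewrite eq_le !wtilde_le_sym. Qed.

Lemma wtilde_triangle D2 D1 D3 :
  (wtilde D1 D3 <= wtilde D1 D2 + wtilde D2 D3)%E.
Proof.
have key (f : matching D1 D2) (g : matching D2 D3) :
    (wtilde D1 D3 <= cost f + cost g)%E.
  have [||h hE] := @matching_of_graph D1 D3
    (fun i k => exists j, m_graph f i j /\ m_graph g j k).
  - move=> i k k' [j [fij gjk]] [j' [fij' gjk']].
    by move: gjk'; rewrite -(m_graph_fun fij fij'); exact: m_graph_fun gjk.
  - move=> i i' k [j [fij gjk]] [j' [fij' gjk']].
    by move: fij'; rewrite -(m_graph_inj gjk gjk'); exact: m_graph_inj fij.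
  have f0 := cost_ge0 f; have g0 := cost_ge0 g.
  apply: le_trans (wtilde_le_cost h) _; apply/cost_leP; first exact: adde_ge0.
  have [f1 f2 f3] := (cost_leP f f0).1 (lexx _).
  have [g1 g2 g3] := (cost_leP g g0).1 (lexx _).
  split=> [i k /hE[j [fij gjk]]|i ni|k nk].
  - apply: (@le_trans _ _ (dist_oo (D1 i) (D2 j) + dist_oo (D2 j) (D3 k))%:E).
      by rewrite lee_fin; exact: dist_oo_triangle.
    by rewrite EFinD; apply: leeD; [exact: f1|exact: g1].
  - have [[j fij]|/f2 nfi] := pselect (exists j, m_graph f i j); last first.
      by apply: le_trans nfi _; exact: leeDl.
    apply: (@le_trans _ _ (dist_oo (D1 i) (D2 j) + dist_diag (D2 j))%:E).
      by rewrite lee_fin; exact: dist_diag_triangle.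
    rewrite EFinD; apply: leeD; [exact: f1|apply: g2 => -[k gjk]].
    by apply: ni; exists k; apply/hE; exists j.
  - have [[j gjk]|/g3 ngk] := pselect (exists j, m_graph g j k); last first.
      by apply: le_trans ngk _; exact: leeDr.
    apply: (@le_trans _ _ (dist_diag (D2 j) + dist_oo (D2 j) (D3 k))%:E).
      by rewrite lee_fin addrC dist_ooC; exact: dist_diag_triangle.
    rewrite EFinD; apply: leeD; [apply: f3 => -[i fij]|exact: g1].
    by apply: nk; exists i; apply/hE; exists j.
have w12 := wtilde_ge0 D1 D2; have w23 := wtilde_ge0 D2 D3.
have [->|f12] := eqVneq (wtilde D1 D2) +oo%E.
  by rewrite addye ?leey// gt_eqF// (lt_le_trans _ w23).
have [->|f23] := eqVneq (wtilde D2 D3) +oo%E.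
  by rewrite addey ?leey// gt_eqF// (lt_le_trans _ w12).
have {}f12 : wtilde D1 D2 \is a fin_num by rewrite ge0_fin_numE// ltey.
have {}f23 : wtilde D2 D3 \is a fin_num by rewrite ge0_fin_numE// ltey.
apply/lee_addgt0Pr => e e0.
have e20 : 0 < e / 2 by rewrite divr_gt0.
have [_ [f _ <-] /ltW hf] := lb_ereal_inf_adherent e20 f12.
have [_ [g _ <-] /ltW hg] := lb_ereal_inf_adherent e20 f23.
apply: le_trans (key f g) _.
by apply: le_trans (leeD hf hg) _; rewrite addeACA -EFinD -splitr.
Qed.

Definition fin_diagram := {D : diagram | (wtilde D dgm_empty < +oo)%E}.

Definition dgm_sim (D1 D2 : fin_diagram) : bool :=
  wtilde (val D1) (val D2) == 0%E.

Lemma dgm_sim_refl : reflexive dgm_sim.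
Proof. by move=> D; apply/eqP; exact: wtildexx. Qed.

Lemma dgm_sim_sym : symmetric dgm_sim.
Proof. by move=> D1 D2; rewrite /dgm_sim wtilde_sym. Qed.

Lemma dgm_sim_trans : transitive dgm_sim.
Proof.
move=> D2 D1 D3 /eqP h12 /eqP h23; apply/eqP/le_anti; rewrite wtilde_ge0 andbT.
by apply: le_trans (wtilde_triangle (val D2) _ _) _; rewrite h12 h23 adde0.
Qed.

Canonical dgm_sim_equiv :=
  EquivRel dgm_sim dgm_sim_refl dgm_sim_sym dgm_sim_trans.

Lemma wtilde_fin (D1 D2 : fin_diagram) :
  wtilde (val D1) (val D2) \is a fin_num.
Proof.
rewrite ge0_fin_numE ?wtilde_ge0//.
apply: le_lt_trans (wtilde_triangle dgm_empty _ _) _.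
by rewrite [wtilde dgm_empty _]wtilde_sym; exact: lte_add_pinfty (valP D1) (valP D2).
Qed.

End diagrams.
Arguments diagram R : clear implicits.
Arguments fin_diagram R : clear implicits.
Arguments dgm_empty R : clear implicits.

Definition Dgm (R : realType) : Type := {eq_quot @dgm_sim_equiv R}.

Section bottleneck.
Context {R : realType}.

HB.instance Definition _ := Choice.on (Dgm R).
HB.instance Definition _ := EqQuotient.on (Dgm R).

Definition bottleneck (x y : Dgm R) : R :=
  fine (wtilde (val (repr x)) (val (repr y))).

Lemma bottleneck_pi (D1 D2 : fin_diagram R) :
  bottleneck (\pi_(Dgm R) D1) (\pi_(Dgm R) D2) =
  fine (wtilde (val D1) (val D2)).
Proof.
have sim (D : fin_diagram R) :
    wtilde (val (repr (\pi_(Dgm R) D))) (val D) = 0%E.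
  apply/eqP; rewrite -/(dgm_sim _ D).
  have /eqmodP : repr (\pi_(Dgm R) D) = D %[mod_eq @dgm_sim_equiv R].
    exact: (reprK (\pi_(Dgm R) D)).
  by [].
rewrite /bottleneck; congr fine; apply/le_anti/andP; split.
  apply: le_trans (wtilde_triangle (val D1) _ _) _; rewrite sim add0e.
  by apply: le_trans (wtilde_triangle (val D2) _ _) _;
    rewrite [X in (_ + X)%E]wtilde_sym sim adde0.
apply: le_trans (wtilde_triangle (val (repr (\pi_(Dgm R) D1))) _ _) _.
rewrite wtilde_sym sim add0e.
apply: le_trans (wtilde_triangle (val (repr (\pi_(Dgm R) D2))) _ _) _.
by rewrite sim adde0.
Qed.

Lemma bottleneckxx x : bottleneck x x = 0.
Proof. by rewrite /bottleneck wtildexx. Qed.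

Lemma bottleneck_positivity x y : bottleneck x y = 0 -> x = y.
Proof.
rewrite /bottleneck => h; rewrite -[x]reprK -[y]reprK.
apply/(@eqmodP _ (@dgm_sim_equiv R)); apply/eqP.
by rewrite -[LHS]fineK ?wtilde_fin// h.
Qed.

Lemma bottleneck_sym x y : bottleneck x y = bottleneck y x.
Proof. by rewrite /bottleneck wtilde_sym. Qed.

Lemma bottleneck_triangle y x z :
  bottleneck x z <= bottleneck x y + bottleneck y z.
Proof.
rewrite /bottleneck -fineD ?wtilde_fin// fine_le ?wtilde_triangle//.
  exact: wtilde_fin.
by rewrite fin_numD !wtilde_fin.
Qed.

HB.instance Definition _ := @isMetric.Build R (Dgm R) bottleneck
  bottleneckxx bottleneck_positivity bottleneck_sym bottleneck_triangle.

End bottleneck.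

Section reach.
Context {R : realType} {Y : metricType R}.
Implicit Types (A : set Y) (a y : Y).

Definition Unp A : set Y :=
  [set y | exists! a, A a /\ point_set_dist (@mdist R Y) y A = mdist y a].

Definition reach_at a A : \bar R :=
  ereal_sup [set r%:E | r in [set r : R | 0 <= r /\ ball a r `<=` Unp A]].

Definition reach A : \bar R := ereal_inf [set reach_at a A | a in A].

End reach.

Section bubenik_wagner.
Context {R : realType} {X : metricType R}.

Definition distances : set R := [set mdist p.1 p.2 | p in [set: X * X]].

Definition bounded_space : Prop := has_ubound distances.

Definition diam : R := sup distances.

Lemma diam_ge0 (x : X) : bounded_space -> 0 <= diam.
Proof. by move=> bX; apply: ub_le_sup => //; exists (x, x) => //=; exact: mdistxx. Qed.

Context (bX : bounded_space) (c : R) (hc : diam < c) (xs : nat -> X).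

(* The index k is shifted by one: it ranges over 0, 1, 2, ... *)
Definition bw_pt (x : X) (k : nat) : R * R :=
  (2 * c * k%:R, 2 * c * k.+1%:R + mdist x (xs k)).

Lemma bw_lt x k : (bw_pt x k).1 < (bw_pt x k).2.
Proof.
have c0 := le_lt_trans (diam_ge0 x bX) hc.
have := mdist_ge0 x (xs k); rewrite /bw_pt/= -[k.+1]addn1 natrD mulrDr mulr1.
by move: (mdist _ _) (_ * k%:R) => d t; lra.
Qed.

Definition bw_diagram (x : X) : diagram R :=
  @Diagram R nat (countableP _) (bw_pt x) (bw_lt x).

Lemma bw_fin x : (wtilde (bw_diagram x) (dgm_empty R) < +oo)%E.
Proof.
have [||f fE] := @matching_of_graph R (bw_diagram x) (dgm_empty R)
  (fun _ _ => False) => //.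
have c0 := le_lt_trans (diam_ge0 x bX) hc.
apply: le_lt_trans (wtilde_le_cost f) _.
apply: (@le_lt_trans _ _ (2 * c)%:E); last exact: ltry.
apply/cost_leP; first by rewrite lee_fin; lra.
split=> [i []|k _|[]].
rewrite lee_fin dist_diagE ?ltW ?bw_lt//= -[k.+1]addn1 natrD mulrDr mulr1.
have : mdist x (xs k) <= diam by apply: ub_le_sup => //; exists (x, xs k).
by move: hc; lra.
Qed.

Definition bw_embed (x : X) : Dgm R :=
  \pi_(Dgm R) (Sub (bw_diagram x) (bw_fin x) : fin_diagram R).

End bubenik_wagner.
Arguments diam {R} X.
Arguments bounded_space {R} X.

(* Main.v *)
Require Import Defs.
From mathcomp Require Import all_boot all_order all_algebra.
From mathcomp Require Import all_classical all_reals all_analysis.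
From mathcomp Require Import generic_quotient lra zify.

(** Let [x] be an accumulation point of [X] and [e] a small positive number.
    Add to [phi x] one extra point at distance [e] from the diagonal and far
    from every point of the diagrams [phi z]. In a matching with [phi z] the
    extra point alone costs at least [e], so the resulting diagram is at
    distance [max e (dist x z)] from [phi z]. Its distance to [X] is therefore
    [e], attained at every [z] with [dist x z <= e], hence at [x] and at some
    [y] different from [x]. *)

Set Implicit Arguments.
Unset Strict Implicit.
Unset Printing Implicit Defensive.

Import Order.TTheory GRing.Theory Num.Theory.

Local Open Scope classical_set_scope.
Local Open Scope ring_scope.

Section add_point.
Context {R : realType} (D : diagram R) (p : R * R) (p12 : p.1 < p.2).

Lemma add_point_countable : countable [set: option (dgm_index D)].
Proof.
have /countable_injP[f fi] := dgm_countable D.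
(* The shift by one frees the code 0 for the extra point. *)
apply/countable_injP; exists (fun o => if o is Some i then (f i).+1 else 0%N).
move=> [i|] [j|] _ _ //= [] fij; congr Some.
by apply: fi => //; exact: mem_set.
Qed.

Definition add_point_pt (o : option (dgm_index D)) : R * R :=
  if o is Some i then D i else p.

Lemma add_point_lt o : (add_point_pt o).1 < (add_point_pt o).2.
Proof. by case: o => [i|//]; exact: dgm_lt. Qed.

Definition add_point : diagram R := Diagram add_point_countable add_point_lt.

(** Any matching of [D] with [E] extends by leaving the extra point unmatched, which adds only the
    term [dist_diag p] to the cost. *)
Lemma wtilde_add_point_le (E : diagram R) :
  (wtilde add_point E <= maxe (dist_diag p)%:E (wtilde D E))%E.
Proof.
rewrite le_max orbC; apply/orP.
(* If [wtilde add_point E] exceeds [dist_diag p], the bound by the maximum of [dist_diag p] and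
   [cost f] is a bound by [cost f], and the infimum over [f] can be taken. *)
have [|dp] := leP (wtilde add_point E) (dist_diag p)%:E; [by right|left].
apply: le_ereal_inf_tmp => _ [f _ <-].
have f0 := cost_ge0 f; have [f1 f2 f3] := (cost_leP f f0).1 (lexx _).
have [||g gE] := @matching_of_graph R add_point E
  (fun o j => if o is Some i then m_graph f i j else False).
- by move=> [i|] j k //; exact: m_graph_fun.
- by move=> [i|] [j|] k // fi fj; rewrite (m_graph_inj fi fj).
have : (wtilde add_point E <= maxe (dist_diag p)%:E (cost f))%E.
  apply: le_trans (wtilde_le_cost g) _.
  apply/cost_leP; first by rewrite le_max f0 orbT.
  split=> [[i|] j /gE // fij|[i|] ni|j nj]; rewrite le_max.
  - by rewrite f1 ?orbT.
  - by rewrite f2 ?orbT// => -[j fij]; apply: ni; exists j; apply/gE.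
  - by rewrite lexx.
  - by rewrite f3 ?orbT// => -[i fij]; apply: nj; exists (Some i); apply/gE.
by rewrite le_max leNgt dp.
Qed.

(** The extra point is either unmatched, at cost [dist_diag p], or matched with a point of [E], by
    hypothesis at least that far away. *)
Lemma wtilde_add_point_ge (E : diagram R) :
  (forall j, dist_diag p <= dist_oo p (E j)) ->
  ((dist_diag p)%:E <= wtilde add_point E)%E.
Proof.
move=> far; apply: le_ereal_inf_tmp => _ [f _ <-].
have [f1 f2 _] := (cost_leP f (cost_ge0 f)).1 (lexx _).
have [[j fj]|nf] := pselect (exists j, m_graph f None j); last exact: f2 nf.
by apply: le_trans (f1 _ _ fj); rewrite lee_fin far.
Qed.

End add_point.

Local Open Scope quotient_scope.

Lemma mdist_pi (R : realType) (D1 D2 : fin_diagram R) :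
  (mdist (\pi_(Dgm R) D1) (\pi_(Dgm R) D2))%:E = wtilde (val D1) (val D2).
Proof. by rewrite [mdist _ _]bottleneck_pi fineK// wtilde_fin. Qed.

Section bw_diagram.
Context {R : realType} {X : metricType R}.
Context (bX : bounded_space X) (c : R) (hc : diam X < c) (xs : nat -> X).

Let D := bw_diagram bX hc xs.

(** Match equal indices: the first coordinates agree, and the triangle inequality bounds the
    difference of the second ones. *)
Lemma wtilde_bw_le x y : (wtilde (D x) (D y) <= (mdist x y)%:E)%E.
Proof.
have [||f fE] := @matching_of_graph R (D x) (D y) eq.
- by move=> i j k -> ->.
- by move=> i j k -> ->.
apply: le_trans (wtilde_le_cost f) _.
apply/cost_leP; first by rewrite lee_fin mdist_ge0.
split=> [i _ /fE <-|i []|j []]; [|by exists i; apply/fE|by exists j; apply/fE].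
rewrite lee_fin /dist_oo /= subrr normr0 ge_max mdist_ge0/=.
have := metric_triangle y x (xs i); have := metric_triangle x y (xs i).
by rewrite (metric_sym y x) ler_norml => h1 h2; apply/andP; split; lra.
Qed.

(* A matching of cost below [c] leaves no point unmatched and cannot move a
   first coordinate [2 * c * k] to another one. *)
Lemma bw_embed_inj : dense (range xs) -> injective (bw_embed bX hc xs).
Proof.
move=> dxs x y xy; apply/eqP/negPn/negP => xNy.
have c0 := le_lt_trans (diam_ge0 x bX) hc.
have d0 : 0 < mdist x y by rewrite mdist_gt0.
have w0 : wtilde (D x) (D y) = 0%E.
  transitivity (mdist (bw_embed bX hc xs x) (bw_embed bX hc xs y))%:E.
    by apply/esym; exact: mdist_pi.
  by rewrite xy mdistxx.
(* The bound [c] forces equal indices to be matched. A point [xs k] within [e] of [x] is then within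
   [2 * e] of [y], so [mdist x y < 3 * e], which the other bound excludes. *)
pose e := Num.min c (mdist x y / 3).
have e0 : 0 < e by rewrite lt_min c0 divr_gt0.
have : (wtilde (D x) (D y) < e%:E)%E by rewrite w0 lte_fin.
move=> /ereal_inf_lt[_ [f _ <-] fe].
have [f1 f2 _] := (cost_leP f (cost_ge0 f)).1 (lexx _).
have [ec ed] : e <= c /\ e <= mdist x y / 3.
  by split; rewrite /e ge_min lexx ?orbT.
have close k : `|mdist x (xs k) - mdist y (xs k)| < e.
  have [[j fkj]|/f2 nk] := pselect (exists j, m_graph f k j); last first.
    have := le_lt_trans nk fe.
    rewrite lte_fin dist_diagE ?ltW ?bw_lt//= -[k.+1]addn1 natrD mulrDr mulr1.
    have := mdist_ge0 x (xs k).
    by move: (mdist x (xs k)) (2 * c * _) => u v; lra.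
  have := le_lt_trans (f1 _ _ fkj) fe.
  rewrite lte_fin /dist_oo gt_max /= => /andP[h1].
  suff -> : j = k by rewrite opprD addrACA subrr add0r.
  apply/eqP; rewrite eq_sym -(eqr_nat R).
  move: h1; rewrite -mulrBr normrM gtr0_norm ?mulr_gt0// => h1.
  have {}h1 : `|k%:R - j%:R : R| < 1.
    rewrite -(@ltr_pM2l _ (2 * c)) ?mulr_gt0//.
    by apply: lt_le_trans h1 _; lra.
  move: h1; rewrite !pmulrn -intrB -intr_norm ltrz1 => h1.
  by rewrite eqr_int; lia.
have [oB Bx] := open_nbhs_ball x (PosNum e0).
have [|z [/interior_subset + [k _ kE]]] := dxs _ _ oB; first by exists x.
rewrite -kE ballEmdist /= => xke.
have := close k; rewrite ltr_norml => /andP[h1 h2].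
have := metric_triangle x (xs k) y; rewrite (metric_sym (xs k) y).
by move: xke h1 h2 ed; lra.
Qed.

Lemma bw_embed_notin_Unp (x y : X) (e : R) : dense (range xs) ->
  0 < e -> e <= c -> y != x -> mdist x y <= e ->
  exists2 P, mdist (bw_embed bX hc xs x) P = e
           & ~ Unp (range (bw_embed bX hc xs)) P.
Proof.
move=> dxs e0 ec yx xye.
(* The height [2 * e] puts [p] at distance [e] from the diagonal. All first coordinates in the
   diagrams of [X] are nonnegative, so [p] is at least [2 * c >= e] away from their points. *)
pose p : R * R := (- (2 * c), - (2 * c) + 2 * e).
have p12 : p.1 < p.2 by rewrite /p/=; lra.
have pe : dist_diag p = e by rewrite dist_diagE ?ltW//= ; lra.
have fin : (wtilde (add_point (D x) p12) (dgm_empty R) < +oo)%E.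
  apply: le_lt_trans (wtilde_add_point_le _ _ _) _.
  by rewrite gt_max ltry bw_fin.
pose P : Dgm R := \pi_(Dgm R) (Sub (add_point (D x) p12) fin : fin_diagram R).
have Pge z : e <= mdist P (bw_embed bX hc xs z).
  rewrite -lee_fin mdist_pi -pe; apply: wtilde_add_point_ge => k; rewrite pe.
  rewrite /dist_oo le_max; apply/orP; left.
  rewrite distrC; apply: le_trans (ler_norm _); rewrite /=.
  have : 0 <= 2 * c * k%:R by rewrite mulr_ge0//; lra.
  by lra.
have Peq z : mdist x z <= e -> mdist P (bw_embed bX hc xs z) = e.
  move=> xz; apply/le_anti; rewrite Pge andbT.
  rewrite -lee_fin mdist_pi.
  apply: le_trans (wtilde_add_point_le _ _ _) _; rewrite pe ge_max lexx/=.
  by apply: le_trans (wtilde_bw_le x z) _; rewrite lee_fin.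
have xxe : mdist x x <= e by rewrite mdistxx ltW.
exists P; first by rewrite metric_sym Peq.
have dP : point_set_dist (@mdist R (Dgm R)) P (range (bw_embed bX hc xs)) = e.
  apply/le_anti/andP; split.
    apply: ge_inf; last by exists (bw_embed bX hc xs x); [exists x|exact: Peq].
    by exists e => _ [_ [z _ <-] <-].
  apply: lb_le_inf => [|_ [_ [z _ <-] <-]//].
  by exists (mdist P (bw_embed bX hc xs x)), (bw_embed bX hc xs x).
have attained z : mdist x z <= e ->
    range (bw_embed bX hc xs) (bw_embed bX hc xs z) /\
    point_set_dist (@mdist R (Dgm R)) P (range (bw_embed bX hc xs)) =
    mdist P (bw_embed bX hc xs z).
  by move=> xz; split; [exists z|rewrite dP Peq].
(* A unique nearest point [a] would equal the images of both [x] and [y], against injectivity. *)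
move=> [a [_ aU]]; move/eqP: yx; apply; apply: (bw_embed_inj dxs).
by transitivity a; [apply/esym|]; apply: aU; exact: attained.
Qed.

End bw_diagram.

Lemma reach_at_ge0 (R : realType) (Y : metricType R) (a : Y) (A : set Y) :
  (0 <= reach_at a A)%E.
Proof.
(* Radius 0 is always admissible, since its open ball is empty. *)
apply: ereal_sup_ubound; exists 0 => //; split=> // y.
by rewrite ballEmdist /= ltNge mdist_ge0.
Qed.

Theorem theorem6p1 (R : realType) (X : metricType R)
  (bX : bounded_space X) (c : R) (hc : diam X < c)
  (xs : nat -> X) (dense_xs : dense (range xs)) :
  let phi : X -> Dgm R := bw_embed bX hc xs in
  (forall x : X, limit_point [set: X] x ->
     reach_at (phi x) (range phi) = 0%E) /\
  ((exists x : X, limit_point [set: X] x) ->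
     reach (range phi) = 0%E).
Proof.
move=> phi.
have at0 x : limit_point [set: X] x -> reach_at (phi x) (range phi) = 0%E.
  move=> lx; apply/le_anti; rewrite reach_at_ge0 andbT.
  apply: ge_ereal_sup => _ [r [r0 rU] <-]; rewrite lee_fin leNgt.
  apply/negP => {}r0.
  have c0 := le_lt_trans (diam_ge0 x bX) hc.
  (* Halving [r] puts a point at distance [e] strictly inside the ball of radius [r]. *)
  pose e := Num.min c (r / 2).
  have e0 : 0 < e by rewrite lt_min c0 divr_gt0.
  have [ec er] : e <= c /\ e <= r / 2 by split; rewrite /e ge_min lexx ?orbT.
  have [y [yx _]] := lx _ (nbhsx_ballx x e e0).
  rewrite ballEmdist /= => /ltW xye.
  have [P xP] := bw_embed_notin_Unp bX hc dense_xs e0 ec yx xye.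
  apply; apply: rU; rewrite ballEmdist /= xP.
  by move: er r0; lra.
split=> // -[x lx]; apply/le_anti/andP; split.
  apply: ge_ereal_inf; exists (reach_at (phi x) (range phi)).
    by exists (phi x) => //; exists x.
  by rewrite at0.
by apply: le_ereal_inf_tmp => _ [a _ <-]; exact: reach_at_ge0.
Qed.
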